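(* Let $(M,g)$ and $(N,h)$ be Riemannian manifolds and let $F:(M,g)\to(N,h)$ be a horizontally conformal submersion with dilation $\lambda$ such that the horizontal distribution $(\mathrm{Ker}F_\ast)^\perp$ is totally geodesic. Then $\lambda$ is constant on $\mathrm{Ker}F_\ast$.
   Context: A horizontally conformal submersion with dilation $\lambda$ is a surjective smooth submersion $F:(M,g)\to(N,h)$ between Riemannian manifolds together with a smooth function $\lambda:M\to\mathbb{R}^+$ such that $h(F_\ast X,F_\ast Y)=\lambda^2(p)\,g(X,Y)$ for all $p\in M$ and all $X,Y\in(\mathrm{Ker}F_{\ast p})^\perp$. The vertical distribution is $\mathrm{Ker}F_\ast$ and the horizontal distribution is its $g$-orthogonal complement $(\mathrm{Ker}F_\ast)^\perp$. The horizontal distribution is totally geodesic if $\nabla_XY$ is horizontal for all horizontal vector fields $X,Y$, where $\nabla$ is the Levi-Civita connection of $g$; equivalently the vertical part $A_XY$ of $\nabla_XY$ vanishes. ''$\lambda$ is constant on $\mathrm{Ker}F_\ast$'' means that the vertical part of the gradient of $\lambda$ (equivalently of $1/\lambda^2$) vanishes, i.e. $V(\lambda)=0$ for every vertical vector $V$.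
   Formalization: The manifold N is assumed to have dimension at least 1; if N is a point, every positive smooth function on M is a dilation and the horizontal distribution is zero, so the claim fails (e.g. M the real line, dilation e^x). *)

(* Defs.v *)
From HB Require Import structures.
From mathcomp Require Import all_boot all_order all_algebra.
From mathcomp Require Import all_classical all_reals all_analysis.
Set Implicit Arguments.
Unset Strict Implicit.
Unset Printing Implicit Defensive.
Import Order.TTheory GRing.Theory Num.Theory.
Import numFieldNormedType.Exports.
Local Open Scope classical_set_scope.
Local Open Scope ring_scope.

(* Smoothness (C^oo) on an open set U: every iterated directional derivative
   of f is Frechet differentiable, hence continuous, at every point of U.
   As U is open, values of f outside U play no role. *)
Definition iter_derive (R : realType) (V W : normedModType R)
    (f : V -> W) (vs : seq V) : V -> W :=
  foldr (fun v (h : V -> W) => fun x => 'D_v h x) f vs.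

Definition smooth_on (R : realType) (V W : normedModType R)
    (U : set V) (f : V -> W) : Prop :=
  forall (vs : seq V) (x : V), U x -> differentiable (iter_derive f vs) x.

(* A smooth structure of dimension m (without boundary) on M.  The chart with
   index i is the homeomorphism coord i : dom i -> coord i @` dom i, with
   inverse param i; all maps are total, with irrelevant values elsewhere.
   The chart chart_at p around p is singled out only to give a concrete model
   of the tangent space at p, see below. *)
Record smooth_manifold (R : realType) (m : nat) (M : topologicalType) := {
  manifold_hausdorff : hausdorff_space M;
  manifold_second_countable : @second_countable M;
  chart_index : Type;
  dom : chart_index -> set M;
  coord : chart_index -> M -> 'rV[R]_m;
  param : chart_index -> 'rV[R]_m -> M;
  dom_open : forall i, open (dom i);
  coord_dom_open : forall i, open (coord i @` dom i);
  coordK : forall i p, dom i p -> param i (coord i p) = p;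
  coord_continuous : forall i p, dom i p -> {for p, continuous (coord i)};
  param_continuous : forall i x,
    (coord i @` dom i) x -> {for x, continuous (param i)};
  transition_smooth : forall i j,
    smooth_on (coord i @` (dom i `&` dom j)) (coord j \o param i);
  chart_at : M -> chart_index;
  mem_chart_at : forall p, dom (chart_at p) p
}.

(* The tangent space at p is 'rV[R]_m: a tangent vector is represented by its
   components in the chart chart_at p.  The next two functions are the change
   of components, at p, from chart_at p to the chart i and back. *)
Definition to_chart (R : realType) (m : nat) (M : topologicalType)
    (A : smooth_manifold R m M) (i : chart_index A) (p : M) (v : 'rV[R]_m) :
    'rV[R]_m :=
  'd (coord i \o param (chart_at A p)) (coord (chart_at A p) p) v.

Definition of_chart (R : realType) (m : nat) (M : topologicalType)
    (A : smooth_manifold R m M) (i : chart_index A) (p : M) (a : 'rV[R]_m) :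
    'rV[R]_m :=
  'd (coord (chart_at A p) \o param i) (coord i p) a.

Definition smooth_function (R : realType) (m : nat) (M : topologicalType)
    (A : smooth_manifold R m M) (f : M -> R) : Prop :=
  forall i : chart_index A, smooth_on (coord i @` dom i) (f \o param i).

Definition dfun (R : realType) (m : nat) (M : topologicalType)
    (A : smooth_manifold R m M) (f : M -> R) (p : M) (v : 'rV[R]_m) : R :=
  'd (f \o param (chart_at A p)) (coord (chart_at A p) p) v.

Definition smooth_map (R : realType) (m n : nat) (M N : topologicalType)
    (A : smooth_manifold R m M) (B : smooth_manifold R n N)
    (F : M -> N) : Prop :=
  continuous F /\
  forall (i : chart_index A) (j : chart_index B),
    smooth_on (coord i @` (dom i `&` F @^-1` dom j))
              (coord j \o F \o param i).

(* The differential F_* at p, from T_p M to T_(F p) N. *)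
Definition dmap (R : realType) (m n : nat) (M N : topologicalType)
    (A : smooth_manifold R m M) (B : smooth_manifold R n N)
    (F : M -> N) (p : M) (v : 'rV[R]_m) : 'rV[R]_n :=
  'd (coord (chart_at B (F p)) \o F \o param (chart_at A p))
     (coord (chart_at A p) p) v.

(* A vector field is a map p |-> X p, with X p in the tangent space at p. *)
Definition smooth_field (R : realType) (m : nat) (M : topologicalType)
    (A : smooth_manifold R m M) (X : M -> 'rV[R]_m) : Prop :=
  forall i : chart_index A,
    smooth_on (coord i @` dom i)
      (fun x => to_chart i (param i x) (X (param i x))).

(* metric_smooth: the components g_ab = g (d/dx_a, d/dx_b) of g in each chart
   are smooth functions of the coordinates. *)
Record riemannian_metric (R : realType) (m : nat) (M : topologicalType)
    (A : smooth_manifold R m M) := {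
  metric :> M -> 'rV[R]_m -> 'rV[R]_m -> R;
  metric_linear : forall p (a : R) u v w,
    metric p (a *: u + v) w = a * metric p u w + metric p v w;
  metric_sym : forall p u v, metric p u v = metric p v u;
  metric_pos : forall p u, u != 0 -> 0 < metric p u u;
  metric_smooth : forall (i : chart_index A) (a b : 'rV[R]_m),
    smooth_on (coord i @` dom i)
      (fun x => metric (param i x) (of_chart i (param i x) a)
                                   (of_chart i (param i x) b))
}.

(* The derivative X f of a function along a vector field. *)
Definition field_derive (R : realType) (m : nat) (M : topologicalType)
    (A : smooth_manifold R m M) (X : M -> 'rV[R]_m) (f : M -> R) : M -> R :=
  fun p => dfun A f p (X p).

(* Z = [X, Y]: the field acting on functions by Z f = X (Y f) - Y (X f). *)
Definition is_lie_bracket (R : realType) (m : nat) (M : topologicalType)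
    (A : smooth_manifold R m M) (X Y Z : M -> 'rV[R]_m) : Prop :=
  forall f : M -> R, smooth_function A f -> forall p,
    field_derive A Z f p =
    field_derive A X (field_derive A Y f) p
    - field_derive A Y (field_derive A X f) p.

(* nabla X Y is only constrained, and only meant to be used, for smooth X, Y. *)
Record affine_connection (R : realType) (m : nat) (M : topologicalType)
    (A : smooth_manifold R m M)
    (nabla : (M -> 'rV[R]_m) -> (M -> 'rV[R]_m) -> (M -> 'rV[R]_m)) : Prop := {
  nabla_smooth : forall X Y, smooth_field A X -> smooth_field A Y ->
    smooth_field A (nabla X Y);
  nabla_linear_l : forall (f : M -> R) X X' Y, smooth_function A f ->
    smooth_field A X -> smooth_field A X' -> smooth_field A Y -> forall p,
    nabla (fun q => f q *: X q + X' q) Y p = f p *: nabla X Y p + nabla X' Y p;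
  nabla_add_r : forall X Y Y',
    smooth_field A X -> smooth_field A Y -> smooth_field A Y' -> forall p,
    nabla X (fun q => Y q + Y' q) p = nabla X Y p + nabla X Y' p;
  nabla_leibniz : forall (f : M -> R) X Y, smooth_function A f ->
    smooth_field A X -> smooth_field A Y -> forall p,
    nabla X (fun q => f q *: Y q) p =
    field_derive A X f p *: Y p + f p *: nabla X Y p
}.

Record levi_civita (R : realType) (m : nat) (M : topologicalType)
    (A : smooth_manifold R m M) (g : riemannian_metric A)
    (nabla : (M -> 'rV[R]_m) -> (M -> 'rV[R]_m) -> (M -> 'rV[R]_m)) : Prop := {
  lc_connection : affine_connection A nabla;
  lc_torsion_free : forall X Y, smooth_field A X -> smooth_field A Y ->
    is_lie_bracket A X Y (fun p => nabla X Y p - nabla Y X p);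
  lc_metric : forall X Y Z,
    smooth_field A X -> smooth_field A Y -> smooth_field A Z -> forall p,
    field_derive A X (fun q => g q (Y q) (Z q)) p =
    g p (nabla X Y p) (Z p) + g p (Y p) (nabla X Z p)
}.

(* Ker F_* *)
Definition vertical (R : realType) (m n : nat) (M N : topologicalType)
    (A : smooth_manifold R m M) (B : smooth_manifold R n N)
    (F : M -> N) (p : M) : set 'rV[R]_m :=
  [set v | dmap A B F p v = 0].

(* (Ker F_* )^perp *)
Definition horizontal (R : realType) (m n : nat) (M N : topologicalType)
    (A : smooth_manifold R m M) (B : smooth_manifold R n N)
    (g : riemannian_metric A) (F : M -> N) (p : M) : set 'rV[R]_m :=
  [set x | forall v, vertical A B F p v -> g p x v = 0].

Record horizontally_conformal_submersion (R : realType) (m n : nat)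
    (M N : topologicalType)
    (A : smooth_manifold R m M) (B : smooth_manifold R n N)
    (g : riemannian_metric A) (h : riemannian_metric B)
    (F : M -> N) (lambda : M -> R) : Prop := {
  hcs_surjective : range F = setT;
  hcs_smooth : smooth_map A B F;
  hcs_submersion : forall p, range (dmap A B F p) = setT;
  hcs_dilation_smooth : smooth_function A lambda;
  hcs_dilation_pos : forall p, 0 < lambda p;
  hcs_conformal : forall p x y,
    horizontal B g F p x -> horizontal B g F p y ->
    h (F p) (dmap A B F p x) (dmap A B F p y) = lambda p ^+ 2 * g p x y
}.

Definition horizontal_totally_geodesic (R : realType) (m n : nat)
    (M N : topologicalType)
    (A : smooth_manifold R m M) (B : smooth_manifold R n N)
    (g : riemannian_metric A)
    (nabla : (M -> 'rV[R]_m) -> (M -> 'rV[R]_m) -> (M -> 'rV[R]_m))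
    (F : M -> N) : Prop :=
  forall X Y, smooth_field A X -> smooth_field A Y ->
    (forall p, horizontal B g F p (X p)) ->
    (forall p, horizontal B g F p (Y p)) ->
    forall p, horizontal B g F p (nabla X Y p).

Definition constant_on_vertical (R : realType) (m n : nat)
    (M N : topologicalType)
    (A : smooth_manifold R m M) (B : smooth_manifold R n N)
    (F : M -> N) (lambda : M -> R) : Prop :=
  forall p v, vertical A B F p v -> dfun A lambda p v = 0.

(* Main.v *)
From Pilot Require Import Defs.
From HB Require Import structures.
From mathcomp Require Import all_boot all_order all_algebra.
From mathcomp Require Import all_classical all_reals all_analysis.
From mathcomp Require Import ring lra.
(* The preceding imports shadow [coord]. *)
Import Pilot.Defs.
Import Order.TTheory GRing.Theory Num.Theory.
Import numFieldNormedType.Exports.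
Local Open Scope classical_set_scope.
Local Open Scope ring_scope.
Set Implicit Arguments.
Unset Strict Implicit.
Unset Printing Implicit Defensive.

(** Near a point p, let y_1, ..., y_n be coordinates of N around F p, put
f_l = y_l o F, and let X_l be the gradient of f_l.  The X_l are horizontal, and
g (X_k, .) = df_k.  The Hessian g (nabla_Z X_k, Y) is symmetric in Z and Y,
because nabla is metric and torsion free ([nabla_gradient_sym]).  So, when Z p
is a vertical vector v,
  Z (g (X_k, X_l)) = g (nabla_(X_l) X_k, Z) + g (nabla_(X_k) X_l, Z),
which vanishes at p as nabla_(X_l) X_k is horizontal
([derive_gradient_metric]): the functions K_kl = g (X_k, X_l) have derivative
zero along v.

Conformality compares K with the matrix H_kl = h (d/dy_k, d/dy_l) o F.  The
coordinates of F_* X_k are the K_kl, hence K H K^T = lambda^2 K, and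
K H = lambda^2 I since K is invertible ([dilation_gram]).  Thus lambda^2 is the
sum over l of K_kl H_lk, for any fixed k.  The functions H_lk also have
derivative zero along v, as they factor through F and F_* v = 0.  So
2 lambda d lambda (v) = 0, and lambda > 0.

The connection acts on globally defined smooth fields and total geodesy speaks
of fields that are horizontal everywhere, so the f_l and X_l have to be cut
off ([exists_horizontal_gradient]).  This needs smooth bump functions
([exists_bump]), built from exp (- 1 / t), and therefore the stability of smooth
functions under algebraic operations, inversion and composition with
exp (- 1 / t); the same closure properties give the smoothness of gradients,
through the inverse of the Gram matrix of the metric. *)

(** * Germs of differentiable maps and flat functions *)

Lemma near_eq_diff (R : realType) (V W : normedModType R) (f g : V -> W)
    (x : V) :
  (\near x, f x = g x) -> differentiable f x ->
  differentiable g x /\ 'd g x = 'd f x :> (V -> W).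
Proof.
move=> fg df.
have gE : g \o shift x = cst (g x) + 'd f x +o_ 0 id.
  apply/eqaddoP => e e0.
  have /diff_locally/eqaddoP/(_ e e0) := df.
  have : \forall h \near 0, f (h + x) = g (h + x).
    by have := fg; rewrite (near_shift 0 x) /= subr0.
  apply: filterS2 => h /= fgh; rewrite !fctE /= fgh.
  by rewrite -(nbhs_singleton fg).
have dg : 'd g x = 'd f x :> (V -> W).
  by apply: diff_unique => //; exact: diff_continuous.
split => //; apply/diff_locallyP; rewrite dg; split => //.
exact: diff_continuous.
Unshelve. all: by end_near. Qed.

(** The family exp (- 1 / t) / t ^ k, extended by 0, rather than k = 0 alone:
it is stable under derivation up to linear combinations. *)
Definition flat (R : realType) (k : nat) (t : R) : R :=
  if 0 < t then t^-1 ^+ k * expR (- t^-1) else 0.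

Lemma flat_gt0 (R : realType) k (t : R) : 0 < t -> 0 < flat k t.
Proof.
by move=> t0; rewrite /flat t0 mulr_gt0 ?expR_gt0 ?exprn_gt0 ?invr_gt0.
Qed.

Lemma flat_eq0 (R : realType) k (t : R) : t <= 0 -> flat k t = 0.
Proof. by move=> t0; rewrite /flat ltNge t0. Qed.

Lemma flat_ge0 (R : realType) k (t : R) : 0 <= flat k t.
Proof. by case: (ltrP 0 t) => [/(flat_gt0 k)/ltW|/(flat_eq0 k) ->]. Qed.

(** The quadratic bound gives flat functions the derivative 0 at 0; it follows
from s ^ (k + 2) / (k + 2)! <= exp s for s = 1 / t. *)
Lemma flat_le (R : realType) k (t : R) :
  0 <= flat k t <= (k.+2)`!%:R * t ^+ 2.
Proof.
rewrite flat_ge0 /=; have [t0|t0] := ltrP 0 t; last first.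
  by rewrite flat_eq0// mulr_ge0 ?sqr_ge0.
have s0 : 0 < t^-1 by rewrite invr_gt0.
rewrite /flat t0 expRN ler_pdivrMr ?expR_gt0//.
have := expR_ge1Dxn k.+1 (ltW s0); set e := expR _ => he.
have {he} : t^-1 ^+ k.+2 / (k.+2)`!%:R <= e.
  by apply: le_trans he; rewrite lerDr.
rewrite ler_pdivrMr ?ltr0n ?fact_gt0// => he.
have -> : t^-1 ^+ k = t ^+ 2 * t^-1 ^+ k.+2.
  by rewrite -[k.+2]/(2 + k)%N exprD mulrA -exprMn mulfV ?gt_eqF// expr1n mul1r.
by rewrite [leRHS]mulrAC [leRHS]mulrC ler_pM2l ?exprn_gt0// [leRHS]mulrC.
Qed.

Lemma is_derive_flat (R : realType) k (t : R) :
  is_derive t 1 (@flat R k) (flat k.+2 t - k%:R * flat k.+1 t).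
Proof.
have [t0|t0|->] := ltrgtP t 0.
- rewrite !flat_eq0 ?ltW// mulr0 subr0.
  apply: (@near_eq_is_derive _ _ _ (cst 0)).
  near=> s; rewrite flat_eq0//; apply/ltW.
  by near: s; exact: lt_nbhsl.
- have flatE j : flat j t = t^-1 ^+ j * expR (- t^-1) by rewrite /flat t0.
  rewrite !{}flatE.
  have t1 : t != 0 by rewrite gt_eqF.
  have D1 : is_derive t 1 (fun t : R => t^-1) (- t ^- 2).
    have := @is_deriveV R id t 1 1 t1 (is_derive_id _ _).
    by rewrite /GRing.scale/= mulr1.
  have D2 : is_derive t 1 (fun t : R => expR (- t^-1)) (expR (- t^-1) * t ^- 2).
    have D3 : is_derive t 1 (fun t : R => - t^-1) (t ^- 2).
      by have := is_deriveN D1; rewrite opprK.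
    have := @is_derive1_comp R expR _ t _ _ (is_derive_expR _) D3.
    by rewrite /GRing.scale/= mulrC.
  have := is_deriveM (is_deriveX k D1) D2.
  rewrite /GRing.scale/= => H.
  have {H} : is_derive t 1 (fun t => t^-1 ^+ k * expR (- t^-1))
      (t^-1 ^+ k.+2 * expR (- t^-1) - k%:R * (t^-1 ^+ k.+1 * expR (- t^-1))).
    have -> : (fun t : R => t^-1 ^+ k * expR (- t^-1)) =
       (fun t : R => t^-1) ^+ k * (fun t : R => expR (- t^-1)).
      by apply/funext => s; rewrite !fctE.
    apply: is_derive_eq H _.
    rewrite exprfctE !exprVn; case: k => [|k].
      by rewrite !expr0 /= !mul0r mulr0 subr0 addr0 invr1 mul1r mulrC.
    by rewrite /= !exprS; field; rewrite expf_neq0// t1.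
  apply: near_eq_is_derive.
  near=> s; rewrite /flat ifT//.
  by near: s; exact: lt_nbhsr.
- rewrite !(@flat_eq0 R _ 0) ?lexx// mulr0 subr0.
  have dq : (fun h => h^-1 *: ((@flat R k \o shift 0) (h *: 1) - flat k 0))
            @ 0^' --> (0 : R).
    rewrite (@flat_eq0 R _ 0) ?lexx//.
    have lim0 : (fun h : R => k.+2`!%:R * `|h|) @ 0^' --> (0 : R).
      suff : (fun h : R => k.+2`!%:R * `|h|) @ 0^' --> k.+2`!%:R * `|0 : R|.
        by rewrite normr0 mulr0.
      apply: cvgM; first exact: cvg_cst.
      by apply/continuous_withinNx; exact: norm_continuous.
    apply: (@squeeze_cvgr _ _ _ _ (fun h : R => - (k.+2`!%:R * `|h|))
              (fun h : R => k.+2`!%:R * `|h|)).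
    + near=> h; rewrite subr0 /= addr0 /GRing.scale/= mulr1 -ler_norml.
      have h0 : h != 0 by near: h; exact: nbhs_dnbhs_neq.
      rewrite normrM normfV mulrC ler_pdivrMr ?normr_gt0// -mulrA -expr2.
      have /andP[f0 f1] := flat_le k h.
      by rewrite ger0_norm// real_normK ?num_real.
    + by rewrite -[X in _ --> X]oppr0; apply: cvgN.
    + exact: lim0.
  apply: DeriveDef; first by apply/cvg_ex; exists 0.
  by apply: cvg_lim => //.
Unshelve. all: by end_near. Qed.

(** * Algebra of smooth functions *)

Lemma smooth_on_diff (R : realType) (V W : normedModType R) (U : set V)
  (f : V -> W) x : smooth_on U f -> U x -> differentiable f x.
Proof. by move=> fU Ux; exact: (fU [::]). Qed.

Lemma smooth_on_derive (R : realType) (V W : normedModType R) (U : set V)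
  (f : V -> W) v : smooth_on U f -> smooth_on U (fun x => 'D_v f x).
Proof.
move=> fU vs x Ux; have := fU (rcons vs v) x Ux.
by rewrite /iter_derive foldr_rcons.
Qed.

Lemma smooth_on_cst (R : realType) (V W : normedModType R) (U : set V) (c : W) :
  smooth_on U (fun _ : V => c).
Proof.
move=> vs x Ux; suff [d ->] : exists d, iter_derive (fun _ : V => c) vs = cst d.
  exact: differentiable_cst.
elim: vs => [|v vs [d ihvs]] /=; first by exists c.
by exists 0; rewrite ihvs; apply/funext => y; rewrite derive_cst.
Qed.

(** Closing the smooth functions under all the needed operations at once makes
the class stable under directional derivatives: the derivative of a generated
function is generated, so no Leibniz or chain rule of higher order is needed.
The last constructor is there because derivatives are only known on [U]. *)
Inductive smooth_alg (R : realType) (V : normedModType R) (U : set V) :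
    (V -> R) -> Prop :=
| smooth_alg_base f : smooth_on U f -> smooth_alg U f
| smooth_algD f g : smooth_alg U f -> smooth_alg U g ->
    smooth_alg U (fun x => f x + g x)
| smooth_algM f g : smooth_alg U f -> smooth_alg U g ->
    smooth_alg U (fun x => f x * g x)
| smooth_algV f : smooth_alg U f -> (forall x, U x -> f x != 0) ->
    smooth_alg U (fun x => (f x)^-1)
| smooth_alg_flat k f : smooth_alg U f -> smooth_alg U (fun x => flat k (f x))
| smooth_alg_eq f g : (forall x, U x -> f x = g x) ->
    smooth_alg U f -> smooth_alg U g.

Lemma differentiable_flat (R : realType) k (t : R) :
  differentiable (@flat R k) t.
Proof. by apply/derivable1_diffP; case: (is_derive_flat k t). Qed.

(** Induction on the generation: each differentiation rule expresses the
derivative by the same constructors. *)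
Lemma smooth_algP (R : realType) (V : normedModType R) (U : set V)
    (f : V -> R) :
  open U -> smooth_alg U f ->
  (forall x, U x -> differentiable f x) /\
  forall v, smooth_alg U (fun x => 'D_v f x).
Proof.
move=> oU; elim=> {f} [f fU|f g _ [df Df] _ [dg Dg]|f g sf [df Df] sg [dg Dg]
  |f sf [df Df] f0|k f sf [df Df]|f g fg _ [df Df]].
- split=> [x Ux|v]; first exact: smooth_on_diff fU Ux.
  exact/smooth_alg_base/smooth_on_derive.
- split=> [x Ux|v].
    by apply: (differentiableD (df _ _) (dg _ _)).
  apply: smooth_alg_eq (smooth_algD (Df v) (Dg v)) => x Ux /=.
  by rewrite (deriveD (f := f) (g := g))//; apply: diff_derivable;
    [exact: df|exact: dg].
- split=> [x Ux|v].
    by apply: (differentiableM (df _ _) (dg _ _)).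
  apply: smooth_alg_eq (smooth_algD (smooth_algM sf (Dg v))
    (smooth_algM sg (Df v))) => x Ux /=.
  by rewrite (deriveM (f := f) (g := g))//; apply: diff_derivable;
    [exact: df|exact: dg].
- split=> [x Ux|v].
    by apply: differentiableV; [exact: df|exact: f0].
  have sfV := smooth_algV sf f0.
  have m1 := smooth_alg_base (@smooth_on_cst R V R U (-1)).
  apply: smooth_alg_eq (smooth_algM m1
    (smooth_algM (smooth_algM sfV sfV) (Df v))) => x Ux /=.
  rewrite deriveV//; [|exact: f0|exact/diff_derivable/df].
  by rewrite mulN1r /GRing.scale/= expr2 invfM mulNr.
- split=> [x Ux|v].
    by apply: differentiable_comp; [exact: df|exact: differentiable_flat].
  have mk := smooth_alg_base (@smooth_on_cst R V R U (- k%:R)).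
  apply: smooth_alg_eq (smooth_algM (smooth_algD (smooth_alg_flat k.+2 sf)
    (smooth_algM mk (smooth_alg_flat k.+1 sf))) (Df v)) => x Ux /=.
  have dk := @differentiable_flat R k (f x).
  rewrite (deriveE _ (df x Ux)) (deriveE _ (differentiable_comp (df x Ux) dk)).
  rewrite (diff_comp (df x Ux) dk) /=.
  rewrite (@diff1E R _ (@flat R k))// derive1E.
  by case: (is_derive_flat k (f x)) => _ ->; rewrite /GRing.scale/= mulNr mulrC.
- have nfg x : U x -> \near x, f x = g x.
    by move=> Ux; have := open_nbhs_nbhs (conj oU Ux); apply: filterS => y;
      exact: fg.
  split=> [x Ux|v]; first by have [] := near_eq_diff (nfg x Ux) (df x Ux).
  apply: smooth_alg_eq (Df v) => x Ux.
  exact: near_eq_derive (nfg x Ux).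
Qed.

Lemma smooth_alg_smooth (R : realType) (V : normedModType R) (U : set V)
  (f : V -> R) : open U -> smooth_alg U f -> smooth_on U f.
Proof.
move=> oU sf vs; suff : smooth_alg U (iter_derive f vs).
  by move=> /(smooth_algP oU)[].
by elim: vs => //= v vs /(smooth_algP oU)[_]; exact.
Qed.

Section smooth_closure.
Variables (R : realType) (V : normedModType R) (U : set V).
Hypothesis oU : open U.
Implicit Types f g : V -> R.

Lemma smooth_onD f g : smooth_on U f -> smooth_on U g ->
  smooth_on U (fun x => f x + g x).
Proof.
by move=> sf sg; apply: smooth_alg_smooth => //; apply: smooth_algD;
  exact: smooth_alg_base.
Qed.

Lemma smooth_onM f g : smooth_on U f -> smooth_on U g ->
  smooth_on U (fun x => f x * g x).
Proof.
by move=> sf sg; apply: smooth_alg_smooth => //; apply: smooth_algM;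
  exact: smooth_alg_base.
Qed.

Lemma smooth_onV f : smooth_on U f -> (forall x, U x -> f x != 0) ->
  smooth_on U (fun x => (f x)^-1).
Proof.
by move=> sf f0; apply: smooth_alg_smooth => //; apply: smooth_algV => //;
  exact: smooth_alg_base.
Qed.

Lemma smooth_on_flat k f : smooth_on U f -> smooth_on U (fun x => flat k (f x)).
Proof.
by move=> sf; apply: smooth_alg_smooth => //; apply: smooth_alg_flat;
  exact: smooth_alg_base.
Qed.

Lemma smooth_on_eq f g : (forall x, U x -> f x = g x) ->
  smooth_on U f -> smooth_on U g.
Proof.
by move=> fg sf; apply: smooth_alg_smooth => //; apply: smooth_alg_eq fg _;
  exact: smooth_alg_base.
Qed.

Lemma smooth_on_sum (I : Type) (s : seq I) (P : pred I) (F : I -> V -> R) :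
  (forall i, P i -> smooth_on U (F i)) ->
  smooth_on U (fun x => \sum_(i <- s | P i) F i x).
Proof.
move=> sF; elim: s => [|i s ihs].
  by apply: smooth_on_eq (@smooth_on_cst R V R U 0) => x _; rewrite big_nil.
have [Pi|Pi] := boolP (P i); last first.
  by apply: smooth_on_eq ihs => x _; rewrite big_cons (negbTE Pi).
by apply: smooth_on_eq (smooth_onD (sF i Pi) ihs) => x _; rewrite big_cons Pi.
Qed.

Lemma smooth_on_prod (I : Type) (s : seq I) (P : pred I) (F : I -> V -> R) :
  (forall i, P i -> smooth_on U (F i)) ->
  smooth_on U (fun x => \prod_(i <- s | P i) F i x).
Proof.
move=> sF; elim: s => [|i s ihs].
  by apply: smooth_on_eq (@smooth_on_cst R V R U 1) => x _; rewrite big_nil.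
have [Pi|Pi] := boolP (P i); last first.
  by apply: smooth_on_eq ihs => x _; rewrite big_cons (negbTE Pi).
by apply: smooth_on_eq (smooth_onM (sF i Pi) ihs) => x _; rewrite big_cons Pi.
Qed.

Lemma smooth_on_det n (G : V -> 'M[R]_n) :
  (forall a b, smooth_on U (fun x => G x a b)) ->
  smooth_on U (fun x => \det (G x)).
Proof.
move=> sG; apply: smooth_on_sum => s _; apply: smooth_onM;
  first exact: smooth_on_cst.
by apply: smooth_on_prod.
Qed.

Lemma smooth_on_invmx n (G : V -> 'M[R]_n) :
  (forall a b, smooth_on U (fun x => G x a b)) ->
  (forall x, U x -> G x \in unitmx) ->
  forall a b, smooth_on U (fun x => invmx (G x) a b).
Proof.
move=> sG uG a b.
have sC : smooth_on U (fun x => cofactor (G x) b a).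
  apply: smooth_onM; first exact: smooth_on_cst.
  by apply: smooth_on_det => i j;
    apply: smooth_on_eq (sG (lift b i) (lift a j)) => x _; rewrite !mxE.
have sD : smooth_on U (fun x => (\det (G x))^-1).
  by apply: smooth_onV; [exact: smooth_on_det|move=> x /uG;
    rewrite unitmxE unitfE].
by apply: smooth_on_eq (smooth_onM sD sC) => x Ux;
  rewrite /invmx (uG x Ux) !mxE.
Qed.

End smooth_closure.

Lemma sub_smooth_on (R : realType) (V W : normedModType R) (A B : set V)
    (f : V -> W) :
  A `<=` B -> smooth_on B f -> smooth_on A f.
Proof. by move=> AB sf vs x /AB; exact: sf. Qed.

Section matrix_valued.
Variables (R : realType) (V : normedModType R) (p q : nat).
Implicit Types f : V -> 'M[R]_(p, q).

Lemma differentiable_mxP f x :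
  differentiable f x <-> forall i j, differentiable (fun y => f y i j) x.
Proof.
split=> [df i j|df].
  exact: (differentiable_comp df (differentiable_coord _ i j)).
have -> : f = \sum_i \sum_j (fun y => f y i j *: delta_mx i j).
  apply/funext => y; rewrite fct_sumE [LHS]matrix_sum_delta.
  by apply: eq_bigr => i _; rewrite fct_sumE.
by do 2![apply: differentiable_sum => ?]; exact: differentiableZl.
Qed.

Lemma iter_derive_coord (U : set V) f : open U ->
  (forall i j, smooth_on U (fun y => f y i j)) ->
  forall vs x, U x -> forall i j,
    iter_derive f vs x i j = iter_derive (fun y => f y i j) vs x.
Proof.
move=> oU sf; elim=> [//|v vs ihvs] x Ux i j /=.
have nE i' j' : \near x,
    iter_derive f vs x i' j' = iter_derive (fun y => f y i' j') vs x.
  by have := open_nbhs_nbhs (conj oU Ux); apply: filterS => y Uy; exact: ihvs.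
have dE i' j' : differentiable (fun y => iter_derive f vs y i' j') x.
  have [] // := near_eq_diff (g := fun y => iter_derive f vs y i' j') _
    (sf i' j' vs x Ux).
  by have := open_nbhs_nbhs (conj oU Ux); apply: filterS => y Uy; rewrite ihvs.
rewrite derive_mx; last by apply/diff_derivable/differentiable_mxP.
by rewrite mxE; exact: near_eq_derive.
Qed.

Lemma smooth_on_mx (U : set V) f : open U ->
  (forall i j, smooth_on U (fun y => f y i j)) -> smooth_on U f.
Proof.
move=> oU sf vs x Ux; apply/differentiable_mxP => i j.
have [] // := near_eq_diff (g := fun y => iter_derive f vs y i j) _
  (sf i j vs x Ux).
have := open_nbhs_nbhs (conj oU Ux); apply: filterS => y Uy.
by rewrite (iter_derive_coord oU sf).
Qed.

Lemma smooth_on_coord (U : set V) f i j : open U ->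
  smooth_on U f -> smooth_on U (fun y => f y i j).
Proof.
move=> oU sf.
have E vs x : U x ->
    iter_derive (fun y => f y i j) vs x = iter_derive f vs x i j.
  elim: vs x => [//|v vs ihvs] x Ux /=.
  have := derive_mx (@diff_derivable _ _ _ _ _ v (sf vs x Ux)).
  move=> ->; rewrite mxE; apply: near_eq_derive.
  by have := open_nbhs_nbhs (conj oU Ux); apply: filterS => y Uy; exact: ihvs.
move=> vs x Ux.
have /differentiable_mxP/(_ i j) d := sf vs x Ux.
have [] // := near_eq_diff (g := iter_derive (fun y => f y i j) vs) _ d.
by have := open_nbhs_nbhs (conj oU Ux); apply: filterS => y Uy; rewrite E.
Qed.

End matrix_valued.

(** * Functions on a manifold in charts *)

Section charts.
Variables (R : realType) (m : nat) (M : topologicalType).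
Variable A : smooth_manifold R m M.
Implicit Types (i j c : chart_index A) (p q : M) (W : set M) (f : M -> R).

Lemma chart_image_open i W : open W -> open (coord i @` (dom i `&` W)).
Proof.
move=> oW; rewrite openE => _ [q [iq Wq] <-].
have iq' : (coord i @` dom i) (coord i q) by exists q.
have n1 := open_nbhs_nbhs (conj (coord_dom_open (i := i)) iq').
have n2 : nbhs (coord i q) (param i @^-1` W).
  apply: (param_continuous iq'); rewrite coordK//.
  exact: (open_nbhs_nbhs (conj oW Wq)).
apply: filterS2 n1 n2 => _ [q' iq'' <-]; rewrite /= coordK// => Wq'.
by exists q'.
Qed.

Lemma chart_image_nbhs i W q : open W -> dom i q -> W q ->
  nbhs (coord i q) (coord i @` (dom i `&` W)).
Proof.
move=> oW iq Wq; apply: open_nbhs_nbhs; split; first exact: chart_image_open.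
by exists q.
Qed.

Lemma near_param i q (P : set M) : dom i q -> nbhs q P ->
  \forall x \near coord i q, P (param i x).
Proof.
move=> iq nP; have iq' : (coord i @` dom i) (coord i q) by exists q.
by apply: (param_continuous iq'); rewrite coordK.
Qed.

(** The chain rule for the transition map; with [f] a coordinate map, the
cocycle identity between transition differentials. *)
Lemma diff_change_chart (V : normedModType R) c i q (f : M -> V) :
  dom c q -> dom i q -> differentiable (f \o param i) (coord i q) ->
  differentiable (f \o param c) (coord c q) /\
  forall v, 'd (f \o param c) (coord c q) v =
    'd (f \o param i) (coord i q) ('d (coord i \o param c) (coord c q) v).
Proof.
move=> cq iq df.
have dT : differentiable (coord i \o param c) (coord c q).
  by apply: (smooth_on_diff (transition_smooth (i := c) (j := i))); exists q.
have Tq : (coord i \o param c) (coord c q) = coord i q by rewrite /= coordK.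
have df' : differentiable (f \o param i) ((coord i \o param c) (coord c q)).
  by rewrite Tq.
have dcomp := differentiable_comp dT df'.
have [] := near_eq_diff (g := f \o param c) _ dcomp.
  have := chart_image_nbhs (dom_open i) cq iq.
  by apply: filterS => _ [q' [cq' iq'] <-] /=; rewrite !coordK.
move=> dfc dE; split => // v.
apply: etrans (congr1 (@^~ v) dE) _.
apply: etrans (congr1 (@^~ v) (diff_comp dT df')) _.
exact: (congr1 (fun y =>
  'd (f \o param i) y ('d (coord i \o param c) (coord c q) v)) Tq).
Qed.

Lemma diff_coord_param c q v : dom c q ->
  'd (coord c \o param c) (coord c q) v = v.
Proof.
move=> cq.
have [] := near_eq_diff (f := id) (g := coord c \o param c) (x := coord c q).
- have := chart_image_nbhs openT cq I.
  by apply: filterS => _ [q' [cq' _] <-] /=; rewrite coordK.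
- exact: ex_diff.
by move=> _ ->; rewrite diff_val.
Qed.

Lemma differentiable_transition c i q : dom c q -> dom i q ->
  differentiable (coord i \o param c) (coord c q).
Proof.
by move=> cq iq; apply: (smooth_on_diff (transition_smooth (i := c) (j := i)));
  exists q.
Qed.

Lemma to_chartK i q : dom i q -> cancel (to_chart i q) (of_chart i q).
Proof.
move=> iq v; have cq := mem_chart_at A q.
have [_ E] := diff_change_chart cq iq (differentiable_transition iq cq).
exact: etrans (esym (E v)) (diff_coord_param v cq).
Qed.

Lemma of_chartK i q : dom i q -> cancel (of_chart i q) (to_chart i q).
Proof.
move=> iq v; have cq := mem_chart_at A q.
have [_ E] := diff_change_chart iq cq (differentiable_transition cq iq).
exact: etrans (esym (E v)) (diff_coord_param v iq).
Qed.

Lemma dfun_chart i q f v : dom i q ->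
  differentiable (f \o param i) (coord i q) ->
  dfun A f q v = 'd (f \o param i) (coord i q) (to_chart i q v).
Proof.
move=> iq df.
have [_ E] := @diff_change_chart R (chart_at A q) i q f
  (mem_chart_at A q) iq df.
exact: E.
Qed.

Lemma dfunB f q : {morph dfun A f q : u v / u - v}.
Proof. by move=> u v; rewrite /dfun linearB. Qed.

Definition smooth_function_on W f : Prop :=
  forall i, smooth_on (coord i @` (dom i `&` W)) (f \o param i).

Lemma smooth_functionT f : smooth_function A f <-> smooth_function_on setT f.
Proof. by split=> sf i; have := sf i; rewrite setIT. Qed.

Lemma sub_smooth_function_on W W' f :
  W `<=` W' -> smooth_function_on W' f -> smooth_function_on W f.
Proof.
move=> WW' sf i; apply: sub_smooth_on (sf i).
by apply: image_subset; exact: setIS.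
Qed.

Lemma smooth_functionW W f : smooth_function A f -> smooth_function_on W f.
Proof. by move=> /smooth_functionT; exact: sub_smooth_function_on. Qed.

Lemma smooth_function_diff i q f : smooth_function A f -> dom i q ->
  differentiable (f \o param i) (coord i q).
Proof. by move=> sf iq; apply: (smooth_on_diff (sf i)); exists q. Qed.

Lemma near_dfun q f f' : smooth_function A f -> (\near q, f q = f' q) ->
  dfun A f' q =1 dfun A f q.
Proof.
move=> sf ff' v; have cq := mem_chart_at A q.
have [_ E] := near_eq_diff (near_param cq ff') (smooth_function_diff sf cq).
by rewrite /dfun; apply: etrans (congr1 (@^~ v) E).
Qed.

Lemma smooth_function_onM W f f' : open W ->
  smooth_function_on W f -> smooth_function_on W f' ->
  smooth_function_on W (fun q => f q * f' q).
Proof.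
by move=> oW sf sf' i; apply: smooth_onM; first exact: chart_image_open.
Qed.

(** Extension by zero: the two open sets [W] and the complement of [C] cover
[M], and smoothness is local. *)
Lemma smooth_function_ext W (C : set M) f : open W -> closed C -> C `<=` W ->
  smooth_function_on W f -> (forall q, ~ C q -> f q = 0) -> smooth_function A f.
Proof.
move=> oW cC CW sf f0 i vs _ [q iq <-].
have [Wq|nWq] := pselect (W q); first by apply: sf; exists q.
suff : smooth_on (coord i @` (dom i `&` ~` C)) (f \o param i).
  by apply; exists q => //; split => // /CW.
apply: smooth_on_eq (@smooth_on_cst R _ R _ 0).
  by apply: chart_image_open; exact: closed_openC.
by move=> _ [q' [iq' Cq'] <-] /=; rewrite coordK// f0.
Qed.

Lemma smooth_coord_comp c a :
  smooth_function_on (dom c) (fun q => coord c q 0 a).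
Proof.
move=> i; apply: (smooth_on_coord 0 a) (transition_smooth (i := i) (j := c)).
exact: chart_image_open (dom_open c).
Qed.

End charts.

(** * Cutoff functions *)

Lemma compact_cube (R : realType) m (x0 : 'rV[R]_m) (r : R) :
  compact [set x : 'rV[R]_m | forall a, `|x ord0 a - x0 ord0 a| <= r].
Proof.
have -> : [set x : 'rV[R]_m | forall a, `|x ord0 a - x0 ord0 a| <= r] =
    [set x : 'rV[R]_m |
      forall a, `[x0 ord0 a - r, x0 ord0 a + r]%classic (x ord0 a)].
  by apply/seteqP; split=> x /= h a; have := h a; rewrite in_itv/= ler_distl.
apply: (@rV_compact R m
  (fun a => `[x0 ord0 a - r, x0 ord0 a + r]%classic)) => a.
exact: segment_compact.
Qed.

(** With s the squared distance to p in a chart, the quotient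
e (r^2 - s) / (e (r^2 - s) + e (s - r^2 / 4)), e = [flat 0], is 1 where
s <= r^2 / 4 and 0 where s >= r^2.  Its support lies in the image of a compact
cube, which is closed as [M] is Hausdorff. *)
Lemma exists_bump (R : realType) (m : nat) (M : topologicalType)
    (A : smooth_manifold R m M) (W : set M) (p : M) :
  open W -> W p ->
  exists2 rho : M -> R, smooth_function A rho &
    (\near p, rho p = 1) /\
    exists C : set M, [/\ closed C, C `<=` W & forall q, ~ C q -> rho q = 0].
Proof.
move=> oW Wp; set c := chart_at A p; have cp : dom c p := mem_chart_at A p.
set x0 := coord c p.
have /nbhs_ballP[e /= e0 eW] := chart_image_nbhs oW cp Wp.
have r0 : 0 < e / 2 by rewrite divr_gt0.
set r := e / 2 in r0 *.
pose K := [set x : 'rV[R]_m | forall a, `|x ord0 a - x0 ord0 a| <= r].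
have KW : K `<=` coord c @` (dom c `&` W).
  move=> x Kx; apply: eW; split=> // i a; rewrite ord1 /ball/= distrC.
  by rewrite (le_lt_trans (Kx a))// /r ltr_pdivrMr// ltr_pMr// ltr1n.
pose s q := \sum_a (coord c q 0 a - x0 0 a) * (coord c q 0 a - x0 0 a).
have s0 q : 0 <= s q by apply: sumr_ge0 => a _; rewrite -expr2 sqr_ge0.
have sK q : s q < r ^+ 2 -> K (coord c q).
  move=> sr a; rewrite -(@ler_pXn2r _ 2) ?nnegrE ?(ltW r0)// real_normK
    ?num_real//.
  apply: le_trans (ltW sr); rewrite /s (bigD1 a)//= expr2 lerDl.
  by apply: sumr_ge0 => b _; rewrite -expr2 sqr_ge0.
pose u q := flat 0 (r ^+ 2 - s q); pose w q := flat 0 (s q - r ^+ 2 / 4).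
have uw0 q : 0 < u q + w q.
  have [sr|sr] := ltrP (s q) (r ^+ 2).
    by rewrite ltr_pwDl ?flat_ge0// flat_gt0// subr_gt0.
  rewrite ltr_wpDl ?flat_ge0// flat_gt0// subr_gt0.
  apply: lt_le_trans sr.
  by rewrite ltr_pdivrMr// ltr_pMr ?exprn_gt0// ltr1n.
pose rho q := if pselect (dom c q) then u q / (u q + w q) else 0.
pose C := param c @` K.
have CW : C `<=` W `&` dom c.
  by move=> _ [x Kx <-]; have [q [cq Wq] <-] := KW _ Kx; rewrite coordK.
have cC : closed C.
  apply: compact_closed; first exact: manifold_hausdorff A.
  apply: continuous_compact; last exact: compact_cube.
  apply: continuous_in_subspaceT => x /[!inE] /KW[q [cq _] <-].
  by apply: param_continuous; exists q.
have rho0 q : ~ C q -> rho q = 0.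
  rewrite /rho; case: pselect => // cq nCq; rewrite /u flat_eq0 ?mul0r//.
  rewrite subr_le0 leNgt; apply/negP => /sK Kq; apply: nCq.
  by exists (coord c q) => //; rewrite coordK.
exists rho; last split.
- apply: (smooth_function_ext (dom_open c) cC) => //; first by move=> q /CW[].
  move=> i; have oU := chart_image_open (i := i) (dom_open c).
  have scst (k : R) := @smooth_on_cst R _ R (coord i @` (dom i `&` dom c)) k.
  have ss : smooth_on (coord i @` (dom i `&` dom c)) (s \o param i).
    apply: smooth_on_sum => // a _.
    have sa : smooth_on (coord i @` (dom i `&` dom c))
        (fun x => coord c (param i x) 0 a - x0 0 a).
      by apply: smooth_onD => //; exact: smooth_coord_comp.
    exact: smooth_onM.
  have su : smooth_on (coord i @` (dom i `&` dom c)) (u \o param i).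
    apply: smooth_on_flat => //.
    have : smooth_on (coord i @` (dom i `&` dom c))
        (fun x => r ^+ 2 + (-1) * (s \o param i) x).
      by apply: smooth_onD => //; apply: smooth_onM.
    by apply: smooth_on_eq => // x _; rewrite mulN1r.
  have sw : smooth_on (coord i @` (dom i `&` dom c)) (w \o param i).
    by apply: smooth_on_flat => //; exact: smooth_onD.
  have := smooth_onM oU su (smooth_onV oU (smooth_onD oU su sw)
    (fun x _ => lt0r_neq0 (uw0 (param i x)))).
  apply: smooth_on_eq => // _ [q [iq cq] <-].
  by rewrite /= coordK// /rho; case: pselect.
- have n1 : \near p, dom c p by exact: open_nbhs_nbhs (conj (dom_open c) cp).
  have cs : {for p, continuous s}.
    apply: cvg_big; first exact: add_continuous.
    move=> a _.
    have ca : (fun q => coord c q 0 a) q @[q --> p] --> coord c p 0 a.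
      exact: (continuous_comp (coord_continuous cp)
        (@matrix_normedtype.coord_continuous R 1 m 0 a _)).
    by apply: cvgM; apply: cvgB ca (cvg_cst _).
  have sp : s p < r ^+ 2 / 4.
    rewrite /s big1 ?divr_gt0 ?exprn_gt0// => a _.
    by rewrite subrr mulr0.
  have n2 : \near p, s p < r ^+ 2 / 4.
    by apply: (cvgr_lt (s p)) => //; exact: cs.
  apply: filterS2 n1 n2 => q cq sq.
  rewrite /rho; case: pselect => //= _.
  rewrite /w flat_eq0 ?subr_le0 ?(ltW sq)// addr0 divff//.
  by have := uw0 q; rewrite /w flat_eq0 ?subr_le0 ?(ltW sq)// addr0 =>
    /lt0r_neq0.
- by exists C; split => // q /CW[].
Qed.

Lemma exists_extension (R : realType) (m : nat) (M : topologicalType)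
    (A : smooth_manifold R m M) (W : set M) (p : M) (u : M -> R) :
  open W -> W p -> smooth_function_on A W u ->
  exists2 f : M -> R, smooth_function A f & \near p, f p = u p.
Proof.
move=> oW Wp su.
have [rho srho [rho1 [C [cC CW rho0]]]] := exists_bump A oW Wp.
exists (fun q => rho q * u q); last first.
  by apply: filterS rho1 => q ->; rewrite mul1r.
apply: (smooth_function_ext oW cC CW); last by move=> q /rho0 ->; rewrite mul0r.
by apply: smooth_function_onM => //; exact: smooth_functionW.
Qed.

(** * The gradient of a function *)

Section gradient.
Variables (R : realType) (m : nat) (M : topologicalType).
Variables (A : smooth_manifold R m M) (g : riemannian_metric A).
Implicit Types (i : chart_index A) (q : M) (f : M -> R).

Lemma metric0l q w : g q 0 w = 0.
Proof.
by have := metric_linear g q 1 0 0 w;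
  rewrite scaler0 addr0 mul1r -[LHS]addr0 => /addrI.
Qed.

Lemma metricZl q a u w : g q (a *: u) w = a * g q u w.
Proof. by have := metric_linear g q a u 0 w; rewrite addr0 metric0l addr0. Qed.

Lemma metricDl q u v w : g q (u + v) w = g q u w + g q v w.
Proof. by have := metric_linear g q 1 u v w; rewrite scale1r mul1r. Qed.

Lemma metricZr q a u w : g q w (a *: u) = a * g q w u.
Proof. by rewrite metric_sym metricZl metric_sym. Qed.

Lemma metricDr q u v w : g q w (u + v) = g q w u + g q w v.
Proof. by rewrite metric_sym metricDl !(metric_sym _ _ w). Qed.

Lemma metric_suml q (I : finType) (u : I -> 'rV[R]_m) w :
  g q (\sum_a u a) w = \sum_a g q (u a) w.
Proof.
by apply: (big_morph (fun u => g q u w)) => [u' v'|];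
  [exact: metricDl|exact: metric0l].
Qed.

Lemma metric_sumr q (I : finType) (u : I -> 'rV[R]_m) w :
  g q w (\sum_a u a) = \sum_a g q w (u a).
Proof.
by rewrite metric_sym metric_suml; apply: eq_bigr => a _; exact: metric_sym.
Qed.

Lemma metric_eq0 q u : g q u u = 0 -> u = 0.
Proof.
by move=> gu; apply/eqP; apply: contraTT isT => /(metric_pos g q);
  rewrite gu ltxx.
Qed.

Lemma metric_inj q u v : (forall w, g q u w = g q v w) -> u = v.
Proof.
move=> uv; apply/eqP; rewrite -subr_eq0; apply/eqP; apply: (@metric_eq0 q).
by rewrite -scaleN1r metricDl metricZl uv mulN1r subrr.
Qed.

Definition gram i q : 'M[R]_m :=
  \matrix_(a, b)
    g q (of_chart i q (delta_mx 0 a)) (of_chart i q (delta_mx 0 b)).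

Lemma of_chart_sum i q (x : 'rV[R]_m) :
  of_chart i q x = \sum_a x 0 a *: of_chart i q (delta_mx 0 a).
Proof.
rewrite [in LHS](row_sum_delta x) /of_chart linear_sum.
by apply: eq_bigr => a _; rewrite linearZ.
Qed.

Lemma metric_of_chart i q (x y : 'rV[R]_m) :
  g q (of_chart i q x) (of_chart i q y) = (x *m gram i q *m y^T) 0 0.
Proof.
rewrite (of_chart_sum i q x) metric_suml (of_chart_sum i q y).
under eq_bigr do rewrite metricZl metric_sumr mulr_sumr.
rewrite exchange_big mxE; apply: eq_bigr => b _.
rewrite mxE mulr_suml; apply: eq_bigr => a _.
by rewrite !mxE metricZr mulrA mulrAC.
Qed.

Lemma gram_unit i q : dom i q -> gram i q \in unitmx.
Proof.
move=> iq; rewrite -row_free_unit -kermx_eq0; apply/rowV0P => x /sub_kermxP xG.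
have : of_chart i q x = 0.
  by apply: (@metric_eq0 q); rewrite metric_of_chart xG mul0mx mxE.
by move/(congr1 (to_chart i q)); rewrite of_chartK// /to_chart linear0.
Qed.

Definition partial i f (x : 'rV[R]_m) : 'rV[R]_m :=
  \row_a 'D_(delta_mx 0 a) (f \o param i) x.

Lemma dfun_partial i q f v : smooth_function A f -> dom i q ->
  dfun A f q v = (partial i f (coord i q) *m (to_chart i q v)^T) 0 0.
Proof.
move=> sf iq; have df := smooth_function_diff sf iq.
rewrite (dfun_chart v iq df) [in LHS](row_sum_delta (to_chart i q v))
  linear_sum mxE.
by apply: eq_bigr => a _; rewrite linearZ !mxE deriveE// /GRing.scale/= mulrC.
Qed.

(** The vector dual to df, computed in the chart [i]; independence of [i] is
what makes the gradient smooth. *)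
Definition gradient_chart i f q : 'rV[R]_m :=
  of_chart i q (partial i f (coord i q) *m invmx (gram i q)).

Lemma gradient_chartP i f q u : smooth_function A f -> dom i q ->
  g q (gradient_chart i f q) u = dfun A f q u.
Proof.
move=> sf iq; rewrite -{1}(to_chartK iq u) metric_of_chart.
by rewrite mulmxKV ?gram_unit// (dfun_partial _ sf iq).
Qed.

Definition gradient f q : 'rV[R]_m := gradient_chart (chart_at A q) f q.

Lemma gradientP f q u : smooth_function A f ->
  g q (gradient f q) u = dfun A f q u.
Proof. by move=> sf; apply: gradient_chartP sf _; exact: mem_chart_at. Qed.

Lemma smooth_partial i f a : smooth_function A f ->
  smooth_on (coord i @` dom i) (fun x => partial i f x 0 a).
Proof.
move=> sf; apply: smooth_on_eq; first exact: coord_dom_open.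
  by move=> x _; rewrite mxE; reflexivity.
exact: smooth_on_derive.
Qed.

(** In the chart [i], the gradient is the product of the partial derivatives
with the inverse Gram matrix, because both expressions represent df. *)
Lemma smooth_gradient f : smooth_function A f -> smooth_field A (gradient f).
Proof.
move=> sf i; have oU := coord_dom_open (i := i).
have sG a b : smooth_on (coord i @` dom i) (fun x => gram i (param i x) a b).
  apply: smooth_on_eq (metric_smooth g (i := i) (delta_mx 0 a) (delta_mx 0 b))
    => // x _.
  by rewrite mxE.
have uG x : (coord i @` dom i) x -> gram i (param i x) \in unitmx.
  by move=> [q iq <-]; rewrite coordK//; exact: gram_unit.
apply: smooth_on_mx => // r a; rewrite ord1.
have : smooth_on (coord i @` dom i)
    (fun x => \sum_b partial i f x 0 b * invmx (gram i (param i x)) b a).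
  apply: smooth_on_sum => // b _; apply: smooth_onM => //;
    first exact: smooth_partial.
  exact: smooth_on_invmx.
apply: smooth_on_eq => // _ [q iq <-]; rewrite coordK//.
have -> : gradient f q = gradient_chart i f q.
  apply: (@metric_inj q) => w.
  exact: etrans (gradientP q w sf) (esym (gradient_chartP w sf iq)).
by rewrite of_chartK// mxE.
Qed.

Lemma smooth_field_scale f (X : M -> 'rV[R]_m) :
  smooth_function A f -> smooth_field A X ->
  smooth_field A (fun q => f q *: X q).
Proof.
move=> sf sX i; have oU := coord_dom_open (i := i).
apply: smooth_on_mx => // r a.
apply: smooth_on_eq (smooth_onM oU (sf i) (smooth_on_coord r a oU (sX i))) =>
  // x _.
by rewrite /to_chart linearZ mxE.
Qed.

Lemma smooth_field_derive f (X : M -> 'rV[R]_m) :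
  smooth_function A f -> smooth_field A X ->
  smooth_function A (field_derive A X f).
Proof.
move=> sf sX i; have oU := coord_dom_open (i := i).
have : smooth_on (coord i @` dom i)
    (fun x => \sum_b partial i f x 0 b *
      to_chart i (param i x) (X (param i x)) 0 b).
  apply: smooth_on_sum => // b _; apply: smooth_onM => //;
    first exact: smooth_partial.
  exact: smooth_on_coord oU (sX i).
apply: smooth_on_eq => // _ [q iq <-].
rewrite /= coordK// /field_derive (dfun_partial _ sf iq) mxE.
by apply: eq_bigr => b _; congr (_ * _); rewrite mxE.
Qed.

(** Every tangent vector extends to a smooth field: take the gradient of a
cut-off linear function in a chart, with differential g (v, .) at p. *)
Lemma exists_field p (v : 'rV[R]_m) : exists2 Z, smooth_field A Z & Z p = v.
Proof.
set c := chart_at A p; have cp : dom c p := mem_chart_at A p.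
pose L (x : 'rV[R]_m) := \sum_a x 0 a * g p v (delta_mx 0 a) : R.
have LE x : L x = g p v x.
  rewrite [in RHS](row_sum_delta x) metric_sumr.
  by apply: eq_bigr => a _; rewrite metricZr.
have Llin : linear L.
  by move=> a x y; rewrite !LE metricDr metricZr.
pose LL : {linear 'rV[R]_m -> R} :=
  HB.pack L (GRing.isLinear.Build _ _ _ _ _ Llin).
have su : smooth_function_on A (dom c) (fun q => L (coord c q)).
  move=> i; have oU := chart_image_open (i := i) (dom_open c).
  apply: smooth_on_sum => // a _; apply: smooth_onM => //;
    last exact: smooth_on_cst.
  exact: smooth_coord_comp.
have [f sf fu] := exists_extension (dom_open c) cp su.
exists (gradient f); first exact: smooth_gradient.
apply: (@metric_inj p) => w; rewrite (gradientP p w sf) -LE /dfun.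
have dL x : differentiable LL x.
  have -> : LL =
      \sum_a (fun x : 'rV[R]_m => x 0 a * g p v (delta_mx 0 a)) :> (_ -> _).
    by apply/funext => y; rewrite fct_sumE.
  by apply: differentiable_sum => a; apply: differentiableZl;
    exact: differentiable_coord.
have [] := near_eq_diff (f := LL) (g := f \o param c) (x := coord c p) _ (dL _).
  have n1 := near_param cp fu.
  have n2 := chart_image_nbhs (dom_open c) cp cp.
  by apply: filterS2 n1 n2 => x /= -> [q [cq _] <-]; rewrite coordK.
move=> _ E; apply: etrans (congr1 (@^~ w) E) _.
have cL : continuous LL by move=> x; exact/differentiable_continuous/dL.
exact: (congr1 (@^~ w) (diff_lin (coord c p) cL)).
Qed.

End gradient.

(** * Horizontal gradients and the dilation *)

Section submersion.
Variables (R : realType) (m n : nat) (M N : topologicalType).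
Variables (A : smooth_manifold R m M) (B : smooth_manifold R n N).
Variables (g : riemannian_metric A) (h : riemannian_metric B).

(** Symmetry of the Hessian of f.  Differentiating g (X, Y) = Y f along Z gives
g (nabla_Z X, Y) = Z (Y f) - (nabla_Z Y) f; exchanging Y and Z, the difference
is ([Z, Y] - (nabla_Z Y - nabla_Y Z)) f = 0. *)
Lemma nabla_gradient_sym nabla (f : M -> R) (X Y Z : M -> 'rV[R]_m) (p : M) :
  levi_civita g nabla -> smooth_function A f ->
  smooth_field A X -> smooth_field A Y -> smooth_field A Z ->
  (\forall q \near p, forall u, g q (X q) u = dfun A f q u) ->
  g p (nabla Z X p) (Y p) = g p (nabla Y X p) (Z p).
Proof.
move=> lc sf sX sY sZ gX.
have gXp := nbhs_singleton gX.
have gXder V : smooth_field A V -> forall u,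
    dfun A (fun q => g q (X q) (V q)) p u = dfun A (field_derive A V f) p u.
  move=> sV u; apply: near_dfun; first exact: smooth_field_derive.
  by apply: filterS gX => q ->.
have := lc_metric lc sZ sX sY p; have := lc_metric lc sY sX sZ p.
rewrite /field_derive !gXder// !gXp.
(* What remains is (nabla_Z Y - nabla_Y Z) f = Z (Y f) - Y (Z f). *)
have := lc_torsion_free lc sZ sY sf p.
rewrite /field_derive dfunB -/(field_derive A Y f) -/(field_derive A Z f).
lra.
Qed.

(** For Z extending v, Z (g (X, Y)) = g (nabla_Z X, Y) + g (X, nabla_Z Y), and
the symmetry of the two Hessians moves Z out of the index of nabla: the terms
become g (nabla_Y X, Z) and g (nabla_X Y, Z), zero because nabla_Y X and
nabla_X Y are horizontal and Z is vertical at p. *)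
Lemma derive_gradient_metric nabla (F : M -> N) (f f' : M -> R)
    (X Y : M -> 'rV[R]_m) (p : M) v :
  levi_civita g nabla -> horizontal_totally_geodesic B g nabla F ->
  smooth_function A f -> smooth_function A f' ->
  smooth_field A X -> smooth_field A Y ->
  (forall q, horizontal B g F q (X q)) ->
  (forall q, horizontal B g F q (Y q)) ->
  (\forall q \near p, forall u, g q (X q) u = dfun A f q u) ->
  (\forall q \near p, forall u, g q (Y q) u = dfun A f' q u) ->
  vertical A B F p v -> dfun A (field_derive A Y f) p v = 0.
Proof.
move=> lc tg sf sf' sX sY hX hY gX gY vv.
have [Z sZ Zp] := exists_field g p v.
have <- : dfun A (fun q => g q (X q) (Y q)) p v =
    dfun A (field_derive A Y f) p v.
  apply: near_dfun; first exact: smooth_field_derive.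
  by apply: filterS gX => q ->.
rewrite -Zp; have := lc_metric lc sZ sX sY p; rewrite {1}/field_derive => ->.
rewrite (nabla_gradient_sym lc sf sX sY sZ gX).
rewrite [X in _ + X]metric_sym (nabla_gradient_sym lc sf' sY sX sZ gY) Zp.
by rewrite (tg Y X sY sX hY hX p v vv) (tg X Y sX sY hX hY p v vv) addr0.
Qed.

Lemma smooth_map_coord (F : M -> N) (j : chart_index B) l : smooth_map A B F ->
  smooth_function_on A (F @^-1` dom j) (fun q => coord j (F q) 0 l).
Proof.
move=> [cF sF] i; apply: (smooth_on_coord 0 l) (sF i j).
apply: chart_image_open; apply: open_comp (dom_open j) => q _; exact: cF.
Qed.

(** Tangent vectors of [N] at nearby points F q are given in varying reference
charts; this reads F_* in the fixed chart [j]. *)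
Lemma diff_coord_map (F : M -> N) (j : chart_index B) q v :
  smooth_map A B F -> dom j (F q) ->
  differentiable (coord j \o F \o param (chart_at A q))
    (coord (chart_at A q) q) /\
  'd (coord j \o F \o param (chart_at A q)) (coord (chart_at A q) q) v =
    to_chart j (F q) (dmap A B F q v).
Proof.
move=> [cF sF] jq; set c := chart_at A q; set k := chart_at B (F q).
have cq : dom c q := mem_chart_at A q.
have kq : dom k (F q) := mem_chart_at B (F q).
have dk : differentiable (coord k \o F \o param c) (coord c q).
  by apply: (smooth_on_diff (sF c k)); exists q.
have dT : differentiable (coord j \o param k)
    ((coord k \o F \o param c) (coord c q)).
  by rewrite /= coordK//; exact: differentiable_transition.
have [] := near_eq_diff (g := coord j \o F \o param c) _
  (differentiable_comp dk dT).
  have oW : open (F @^-1` (dom k `&` dom j)).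
    by apply: open_comp (openI (dom_open k) (dom_open j)) => q' _; exact: cF.
  have := chart_image_nbhs oW cq (conj kq jq).
  by apply: filterS => _ [q' [cq' [kq' _]] <-]; rewrite /= coordK// coordK.
move=> dj dE; split; first exact: dj.
apply: etrans (congr1 (@^~ v) dE) _.
apply: etrans (congr1 (@^~ v) (diff_comp dk dT)) _.
have Tq : (coord k \o F \o param c) (coord c q) = coord k (F q).
  by rewrite /= coordK.
exact: (congr1 (fun y => 'd (coord j \o param k) y
  ('d (coord k \o F \o param c) (coord c q) v)) Tq).
Qed.

Lemma dfun_coord_map (F : M -> N) (j : chart_index B) q v l :
  smooth_map A B F -> dom j (F q) ->
  dfun A (fun q => coord j (F q) 0 l) q v =
    to_chart j (F q) (dmap A B F q v) 0 l.
Proof.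
move=> sF jq; have [dj <-] := diff_coord_map v sF jq.
have /differentiable_mxP/(_ 0 l) djl := dj.
rewrite /dfun -(deriveE v dj) (derive_mx (diff_derivable (v := v) dj)) mxE.
by rewrite (deriveE v djl).
Qed.

(** Write K for the matrix of the g (X k, X l) and H for the Gram matrix of h.
The hypothesis on [X] says that row k of K lists the coordinates of F_* (X k)
in the chart [j] and that the X l are horizontal, so conformality reads
K H K^T = lambda^2 K.  K is invertible: if x K = 0, then the combination w of
the X k with coefficients x has g (w, w) = 0, so w = 0, and testing g (w, .) on
a preimage under F_* of the vector with coordinates x gives |x|^2 = 0. *)
Lemma dilation_gram (F : M -> N) (lambda : M -> R) (j : chart_index B) q
    (X : 'I_n -> 'rV[R]_m) :
  horizontally_conformal_submersion g h F lambda -> dom j (F q) ->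
  (forall l u, g q (X l) u = to_chart j (F q) (dmap A B F q u) 0 l) ->
  (\matrix_(k, l) g q (X k) (X l)) *m gram h j (F q) = (lambda q ^+ 2)%:M.
Proof.
move=> hcs jq gX; set K := \matrix_(k, l) _.
have hX l : horizontal B g F q (X l).
  by move=> u; rewrite /vertical/= gX => ->; rewrite /to_chart linear0 mxE.
have KT : K^T = K by apply/matrixP => k l; rewrite !mxE metric_sym.
have KHK : K *m gram h j (F q) *m K^T = lambda q ^+ 2 *: K.
  apply/matrixP => k l;
    rewrite [RHS]mxE [K k l]mxE -(hcs_conformal hcs (hX k) (hX l)).
  rewrite -{1}(to_chartK jq (dmap A B F q (X k)))
    -{1}(to_chartK jq (dmap A B F q (X l))).
  rewrite metric_of_chart.
  have rowT a : row a K = to_chart j (F q) (dmap A B F q (X a)).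
    by apply/rowP => b; rewrite -gX !mxE metric_sym.
  by rewrite -!rowT -row_mul tr_row [LHS]mxE [RHS]mxE; apply: eq_bigr => b _;
    rewrite [row _ _ _ _]mxE [col _ _ _ _]mxE.
have uK : K \in unitmx.
  rewrite -row_free_unit -kermx_eq0; apply/rowV0P => x /sub_kermxP xK.
  have gw u : g q (\sum_k x 0 k *: X k) u =
      \sum_k x 0 k * to_chart j (F q) (dmap A B F q u) 0 k.
    by rewrite metric_suml; apply: eq_bigr => k _; rewrite metricZl gX.
  have w0 : \sum_k x 0 k *: X k = 0.
    apply: (metric_eq0 (g := g) (q := q)); rewrite metric_sumr big1// => l _.
    rewrite metricZr metric_suml.
    have := congr1 (fun y : 'rV[R]_n => y 0 l) xK; rewrite !mxE => H.
    suff -> : \sum_a g q (x 0 a *: X a) (X l) = 0 by rewrite mulr0.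
    by rewrite -[RHS]H; apply: eq_bigr => k _; rewrite metricZl mxE.
  have [u _ dFu] : range (dmap A B F q) (of_chart j (F q) x).
    by rewrite (hcs_submersion hcs).
  have := gw u; rewrite w0 metric0l dFu of_chartK// => /esym x0.
  apply/rowP => k; rewrite mxE; apply/eqP.
  have : x 0 k * x 0 k = 0.
    by apply: (psumr_eq0P _ x0) => // l _; rewrite -expr2 sqr_ge0.
  by move/eqP; rewrite mulf_eq0 orbb.
by apply: (can_inj (mulmxK uK)); rewrite -[X in _ *m X = _]KT KHK mul_scalar_mx.
Qed.

End submersion.

(** The function y_l o F is cut off to a global [f], and the gradient of [f] is
cut off again inside the open set where [f] is locally y_l o F: elsewhere
the gradient of [f] need not be horizontal. *)
Lemma exists_horizontal_gradient (R : realType) (m n : nat)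
    (M N : topologicalType)
    (A : smooth_manifold R m M) (B : smooth_manifold R n N)
    (g : riemannian_metric A) (F : M -> N) (j : chart_index B) p (l : 'I_n) :
  smooth_map A B F -> dom j (F p) ->
  exists f : M -> R, exists X : M -> 'rV[R]_m,
    [/\ smooth_function A f, smooth_field A X,
        forall q, horizontal B g F q (X q) &
        \forall q \near p, forall u, g q (X q) u = dfun A f q u /\
          dfun A f q u = to_chart j (F q) (dmap A B F q u) 0 l].
Proof.
move=> sF jp; pose W := F @^-1` dom j.
have oW : open W by apply: open_comp (dom_open j) => q _; exact: sF.1.
pose y q : R := coord j (F q) 0 l.
have [f sf fy] := exists_extension oW jp (smooth_map_coord l sF).
pose W1 := (W `&` [set q | f q = y q])^°.
have W1p : W1 p.
  by apply: filterI; [exact: open_nbhs_nbhs (conj oW jp)|exact: fy].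
have dW1 q u : W1 q -> dfun A f q u = to_chart j (F q) (dmap A B F q u) 0 l.
  move=> W1q; have [jq _] := nbhs_singleton W1q.
  rewrite -(dfun_coord_map u l sF jq); apply/esym/near_dfun => //.
  by apply: filterS W1q => q' [_].
have [rho srho [rho1 [C [cC CW rho0]]]] :=
  exists_bump A (@open_interior _ _) W1p.
exists f, (fun q => rho q *: gradient g f q); split=> //.
- by apply: smooth_field_scale => //; exact: smooth_gradient.
- move=> q u vu; rewrite metricZl gradientP//.
  have [/CW W1q|/rho0 ->] := pselect (C q); last by rewrite mul0r.
  by rewrite dW1// vu /to_chart linear0 mxE mulr0.
- have n2 : \near p, W1 p.
    exact: (open_nbhs_nbhs (conj (@open_interior _ _) W1p)).
  apply: filterS2 rho1 n2 => q -> W1q u; split; last exact: dW1.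
  by rewrite scale1r gradientP.
Qed.

(** Only one index k is used, which is where 0 < n enters. *)
Theorem theorem3p2 (R : realType) (m n : nat) (n_gt0 : (0 < n)%N)
  (M N : topologicalType)
  (A : smooth_manifold R m M) (B : smooth_manifold R n N)
  (g : riemannian_metric A) (h : riemannian_metric B)
  (nabla : (M -> 'rV[R]_m) -> (M -> 'rV[R]_m) -> (M -> 'rV[R]_m))
  (nabla_lc : levi_civita g nabla)
  (F : M -> N) (lambda : M -> R)
  (F_hcs : horizontally_conformal_submersion g h F lambda)
  (F_tg : horizontal_totally_geodesic B g nabla F) :
  constant_on_vertical A B F lambda.
Proof.
move=> p v vv.
have sF := hcs_smooth F_hcs; have sl := hcs_dilation_smooth F_hcs.
set c := chart_at A p; set j := chart_at B (F p).
have cp : dom c p := mem_chart_at A p.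
have jp : dom j (F p) := mem_chart_at B (F p).
have /choice[f /choice[X fX]] := fun l => exists_horizontal_gradient g l sF jp.
pose k := Ordinal n_gt0.
have sf l : smooth_function A (f l) by case: (fX l).
have sX l : smooth_field A (X l) by case: (fX l).
have hX l q : horizontal B g F q (X l q) by case: (fX l).
have gX l : \forall q \near p, forall u, g q (X l q) u = dfun A (f l) q u.
  by case: (fX l) => _ _ _; apply: filterS => q H u; have [] := H u.
pose kappa l := field_derive A (X l) (f k).
have skappa l : smooth_function A (kappa l) by exact: smooth_field_derive.
have dkappa l : dfun A (kappa l) p v = 0.
  exact: (derive_gradient_metric nabla_lc F_tg (sf k) (sf l) (sX k) (sX l)
    (hX k) (hX l) (gX k) (gX l) vv).
(* The entries of H are smooth in the chart [j] only, so their derivative along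
   v is taken in coordinates. *)
pose eta l y := gram h j (param j y) l k.
pose phi := coord j \o F \o param c.
have [dphi _] := diff_coord_map v sF jp.
have phip : phi (coord c p) = coord j (F p) by rewrite /phi /= coordK.
have deta l : differentiable (eta l) (phi (coord c p)).
  rewrite phip.
  have -> : eta l = (fun y => h (param j y)
      (of_chart j (param j y) (delta_mx 0 l))
      (of_chart j (param j y) (delta_mx 0 k))).
    by apply/funext => y; rewrite /eta mxE.
  by apply: smooth_on_diff (metric_smooth h (i := j) _ _) _; exists (F p).
have deta_phi l : differentiable (eta l \o phi) (coord c p).
  exact: differentiable_comp dphi (deta l).
(* [eta l \o phi] factors through F, and the derivative of phi along v is
   F_* v = 0. *)
have deta0 l : 'd (eta l \o phi) (coord c p) v = 0.
  apply: etrans (congr1 (@^~ v) (diff_comp dphi (deta l))) _.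
  rewrite /= [X in 'd _ _ X](_ : _ = 0) ?linear0//.
(* The diagonal entry k of K H = lambda^2 I, read in the chart [c]. *)
have near_dilation : \forall x \near coord c p,
    (lambda \o param c) x * (lambda \o param c) x =
    (\sum_l (kappa l \o param c) * (eta l \o phi)) x.
  have nF : \forall q \near p, dom j (F q).
    by apply: sF.1; exact: open_nbhs_nbhs (conj (dom_open j) jp).
  have nX : \forall q \near p, forall l u, g q (X l q) u = dfun A (f l) q u /\
      dfun A (f l) q u = to_chart j (F q) (dmap A B F q u) 0 l.
    by apply: filter_forall => l; case: (fX l).
  apply: filterS (near_param cp (filterI nF nX)) => x [jx Xx].
  set q := param c x in jx Xx *.
  have := dilation_gram (X := fun l => X l q) F_hcs jx
    (fun l u => etrans (Xx l u).1 (Xx l u).2).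
  move=> /(congr1 (fun C : 'M[R]_n => C k k));
    rewrite !mxE eqxx mulr1n expr2 => <-.
  rewrite fct_sumE; apply: eq_bigr => l _.
  rewrite fctE /= /eta /phi /= -/q coordK// mxE; congr (_ * _).
  exact: (Xx k _).1.
have dl := smooth_function_diff sl cp.
have dk l : differentiable (kappa l \o param c) (coord c p).
  exact: smooth_function_diff.
have D1 : 'D_v ((lambda \o param c) * (lambda \o param c)) (coord c p) = 0.
  rewrite (near_eq_derive v near_dilation) derive_sum; last first.
    by move=> l; apply/diff_derivable/differentiableM.
  apply: big1 => l _; rewrite deriveM; [|exact: diff_derivable..].
  rewrite (deriveE v (deta_phi l)) deta0 (deriveE v (dk l)).
  have -> : 'd (kappa l \o param c) (coord c p) v = 0 by exact: dkappa.
  by rewrite !scaler0 addr0.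
have := hcs_dilation_pos F_hcs p => /lt0r_neq0 l0.
move: D1; rewrite deriveM; [|exact: diff_derivable..].
rewrite (deriveE v dl) /= coordK// -/(dfun A lambda p v) => /eqP.
by rewrite -mulr2n mulrn_eq0 /= scaler_eq0 (negbTE l0) /= => /eqP.
Qed.
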